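(* Let $\beta>0$ and let $V:\mathbb{R}^d\to\mathbb{R}$ be smooth. Suppose that $\pi\propto\exp(-V)$ defines a probability measure over $\mathbb{R}^d$ and that $V$ satisfies the two-sided curvature bound $-\beta I\preceq\nabla^2V\preceq\beta I$ on $\mathbb{R}^d$. Then the following hold. 1. (Gradient-entropy bound) For all smooth $f:\mathbb{R}^d\to\mathbb{R}_{>0}$, $$\frac{\|\mathbb{E}_\pi\nabla f\|^2}{\mathbb{E}_\pi f}\le2\beta\,\mathrm{ent}_\pi(f).$$ 2. (Shift Harnack inequality) For all $p>1$, all $v\in\mathbb{R}^d$, and all $f:\mathbb{R}^d\to\mathbb{R}_{>0}$, $$\bigl\{\mathbb{E}_\pi f(\cdot+v)\bigr\}^p\le\exp\Bigl(\frac{\beta p\,\|v\|^2}{2\,(p-1)}\Bigr)\,\mathbb{E}_\pi(f^p).$$ 3. (Reverse Rényi transport inequality) For all $q>1$ and all $v\in\mathbb{R}^d$, $$\mathsf{R}_q(\pi*\delta_v\,\|\,\pi)\le\frac{\beta q\,\|v\|^2}{2}.$$ 4. (Shift log-Harnack inequality) For all $v\in\mathbb{R}^d$ and all $f:\mathbb{R}^d\to\mathbb{R}_{>0}$, $$\mathbb{E}_\pi f(\cdot+v)\le\log\mathbb{E}_\pi(\exp f)+\frac{\beta\,\|v\|^2}{2}.$$ 5. (Reverse KL transport inequality) For all $v\in\mathbb{R}^d$, $$\mathsf{KL}(\pi*\delta_v\,\|\,\pi)\le\frac{\beta\,\|v\|^2}{2}.$$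
   Context: $\mathrm{ent}_\pi(f)=\mathbb{E}_\pi[f\log f]-\mathbb{E}_\pi[f]\log\mathbb{E}_\pi[f]$. Functions $f$ are measurable, and expectations of non-negative functions take values in $[0,\infty]$; the first inequality is understood for smooth positive $f$ for which $\mathbb{E}_\pi\|\nabla f\|$, $\mathbb{E}_\pi f$ and $\mathbb{E}_\pi[f|\log f|]$ are finite. $\pi*\delta_v$ is the translate of $\pi$ by $v$. For probability measures $\mu,\nu$ and $q>1$, the Rényi divergence is $\mathsf{R}_q(\mu\,\|\,\nu)=\frac{1}{q-1}\log\int(\frac{\mathrm{d}\mu}{\mathrm{d}\nu})^q\,\mathrm{d}\nu$ if $\mu\ll\nu$ and $+\infty$ otherwise; $\mathsf{KL}(\mu\,\|\,\nu)=\int\frac{\mathrm{d}\mu}{\mathrm{d}\nu}\log\frac{\mathrm{d}\mu}{\mathrm{d}\nu}\,\mathrm{d}\nu$ if $\mu\ll\nu$ and $+\infty$ otherwise. *)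

(* Defs.v *)
From HB Require Import structures.
From mathcomp Require Import all_boot all_order all_algebra.
From mathcomp Require Import all_classical all_reals all_analysis.
From mathcomp Require Import measurable_realfun.

Set Implicit Arguments.
Unset Strict Implicit.
Unset Printing Implicit Defensive.
Import Order.TTheory GRing.Theory Num.Theory.
Import numFieldNormedType.Exports.

Local Open Scope classical_set_scope.
Local Open Scope ring_scope.

(** R^d is ['rV[R]_d] with its Borel sigma-algebra. The library norm on
    ['rV[R]_d] is the max norm: it only serves for the topology, the Euclidean
    norm is [enorm] below. *)

Definition borel_rV (R : realType) (d : nat) : set (set 'rV[R]_d) :=
  <<s [set A | open A] >>.

Fact rV_display : measure_display. Proof. by []. Qed.

Section borel_rV_instance.
Variables (R : realType) (d : nat).

Let borel0 : borel_rV (@set0 'rV[R]_d). Proof. exact: sigma_algebra0. Qed.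

Let borelC A : @borel_rV R d A -> borel_rV (~` A).
Proof. exact: sigma_algebraC. Qed.

Let borel_bigcup (F : (set 'rV[R]_d)^nat) :
  (forall i, borel_rV (F i)) -> borel_rV (\bigcup_i (F i)).
Proof. exact: sigma_algebra_bigcup. Qed.

HB.instance Definition _ := @isMeasurable.Build rV_display 'rV[R]_d
  (@borel_rV R d) borel0 borelC borel_bigcup.

End borel_rV_instance.

Section borel_rV_lemmas.
Variable R : realType.

Lemma open_measurable_rV d (A : set 'rV[R]_d) : open A -> measurable A.
Proof. exact: sub_sigma_algebra. Qed.

Lemma continuous_measurable_rV d (f : 'rV[R]_d -> R) :
  continuous f -> measurable_fun setT f.
Proof.
move=> /continuousP cf; apply: (measurability _ (RGenOpens.measurableE R)).
move=> _ [_ [a [b ->] <-]]; rewrite setTI; apply: open_measurable_rV.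
exact/cf/interval_open.
Qed.

Lemma measurable_coord_rV d (i : 'I_d) :
  measurable_fun setT (fun x : 'rV[R]_d => x 0 i).
Proof. by apply: continuous_measurable_rV; exact: coord_continuous. Qed.

Let box d (p : 'rV[rat]_d * nat) : set 'rV[R]_d :=
  [set x | forall i, `|x 0 i - ratr (p.1 0 i)| < p.2.+1%:R^-1].

Let open_bigcup_box d (A : set 'rV[R]_d) : open A ->
  A = \bigcup_p (if `[< box p `<=` A >] then box p else set0).
Proof.
move=> oA; apply/seteqP; split => [x Ax|x [p _]]; last first.
  by case: asboolP => // pA /pA.
have : nbhs x A by exact: open_nbhs_nbhs.
rewrite -nbhs_ballE => -[e /= e0 xeA].
have [k ke] : exists k, k.+1%:R^-1 < e / 2.
  have e20 : 0 < e / 2 by rewrite divr_gt0.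
  have [k _ hk] := near_infty_natSinv_lt (PosNum e20).
  by exists k; exact: (hk k (leqnn k)).
have k0 : 0 < k.+1%:R^-1 :> R by rewrite invr_gt0.
have h (i : 'I_d) : exists q : rat, `|x 0 i - ratr q| < k.+1%:R^-1.
  have /rat_in_itvoo[q] : x 0 i - k.+1%:R^-1 < x 0 i + k.+1%:R^-1.
    by rewrite ltrD2l gtrN.
  rewrite in_itv/= => /andP[q1 q2]; exists q.
  by rewrite distrC ltr_distl q1 q2.
pose p := (\row_i projT1 (cid (h i)), k).
have bx : box p x by move=> i; rewrite mxE; case: cid.
exists p => //; rewrite asboolT// => y py; apply: xeA; split => // i j.
rewrite /ball /= ord1.
rewrite -(subrK (ratr (p.1 0 j)) (x 0 j)) -addrA.
rewrite (le_lt_trans (ler_normD _ _))// (splitr e) ltrD//.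
  exact: lt_trans (bx j) ke.
by rewrite distrC; exact: lt_trans (py j) ke.
Qed.

Lemma measurable_fun_rVP d0 (T : measurableType d0) d (f : T -> 'rV[R]_d) :
  measurable_fun setT f <-> forall i, measurable_fun setT (fun t => f t 0 i).
Proof.
split => [mf i|mf].
  exact: (measurableT_comp (measurable_coord_rV i) mf).
apply: (@measurability _ _ _ _ _ _ [set A : set 'rV[R]_d | open A]) => //.
move=> _ [A /= oA <-]; rewrite setTI (open_bigcup_box oA) preimage_bigcup.
apply: countable_bigcupT_measurable => // p.
case: ifPn => _; last by rewrite preimage_set0.
rewrite (_ : _ @^-1` _ = \bigcap_(i in [set: 'I_d])
    [set t | `|f t 0 i - ratr (p.1 0 i)| < p.2.+1%:R^-1]); last first.
  by apply/seteqP; split => [t h i _|t h i]; exact: h.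
apply: fin_bigcap_measurable => // i _.
have mg : measurable_fun setT (fun t => `|f t 0 i - ratr (p.1 0 i)|).
  by apply: measurableT_comp => //; exact: measurable_funB.
rewrite -[X in measurable X]setTI.
rewrite (_ : [set t | _] = (fun t => `|f t 0 i - ratr (p.1 0 i)|) @^-1`
  `]-oo, p.2.+1%:R^-1[%classic); first exact: mg.
by apply/seteqP; split => t /=; rewrite in_itv.
Qed.

Lemma measurable_shift_rV d (v : 'rV[R]_d) :
  measurable_fun setT (fun x : 'rV[R]_d => x + v).
Proof.
apply/measurable_fun_rVP => i.
under eq_fun do rewrite mxE.
by apply: measurable_funD => //; exact: measurable_coord_rV.
Qed.

End borel_rV_lemmas.

Section measure_sigma_finite.
Context (disp : measure_display) (T : measurableType disp) (R : realType).
Variable m : {measure set T -> \bar R}.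

Definition measure_sigma_finite of sigma_finite setT m : set T -> \bar R := m.

Hypothesis sm : sigma_finite setT m.

HB.instance Definition _ := Measure.copy (measure_sigma_finite sm) m.
HB.instance Definition _ :=
  Measure_isSigmaFinite.Build _ _ _ (measure_sigma_finite sm) sm.

End measure_sigma_finite.

Section lebesgue_rV.
Variable R : realType.

Definition cons_rV d (p : R * 'rV[R]_d) : 'rV[R]_d.+1 := row_mx p.1%:M p.2.

Definition uncons_rV d (x : 'rV[R]_d.+1) : R * 'rV[R]_d :=
  (x 0 0, \row_i x 0 (lift 0 i)).

Lemma cons_rV0 d (p : R * 'rV[R]_d) : cons_rV p 0 0 = p.1.
Proof.
have -> : 0 = lshift d 0 :> 'I_(1 + d) by exact/val_inj.
by rewrite [LHS]row_mxEl mxE eqxx.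
Qed.

Lemma cons_rV_lift d (p : R * 'rV[R]_d) i : cons_rV p 0 (lift 0 i) = p.2 0 i.
Proof.
have -> : lift 0 i = rshift 1 i :> 'I_(1 + d) by exact/val_inj.
exact: row_mxEr.
Qed.

Lemma cons_rVK d : cancel (@cons_rV d) (@uncons_rV d).
Proof.
move=> p; rewrite [RHS]surjective_pairing /uncons_rV cons_rV0; congr pair.
by apply/rowP => i; rewrite mxE cons_rV_lift.
Qed.

Lemma uncons_rVK d : cancel (@uncons_rV d) (@cons_rV d).
Proof.
move=> x; apply/rowP => i; case: (unliftP 0 i) => [j|] ->.
  by rewrite cons_rV_lift mxE.
by rewrite cons_rV0.
Qed.

Lemma measurable_cons_rV d : measurable_fun setT (@cons_rV d).
Proof.
apply/measurable_fun_rVP => i; case: (unliftP 0 i) => [j|] ->.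
  under eq_fun do rewrite cons_rV_lift.
  exact: (measurableT_comp (measurable_coord_rV j) measurable_snd).
under eq_fun do rewrite cons_rV0.
exact: measurable_fst.
Qed.

Lemma measurable_uncons_rV d : measurable_fun setT (@uncons_rV d).
Proof.
apply: measurable_fun_pair; first exact: measurable_coord_rV.
apply/measurable_fun_rVP => i; under eq_fun do rewrite mxE.
exact: measurable_coord_rV.
Qed.

(* d-fold product of the Lebesgue measure of R: the first coordinate is split
   off by [cons_rV]; [lebesgue_rV_box] gives the volume of boxes. *)
Fixpoint lebesgue_rV (d : nat) : set 'rV[R]_d -> \bar R :=
  if d is d'.+1 then
    pushforward (@lebesgue_measure R \x @lebesgue_rV d')%E (@cons_rV d')
  else dirac (0 : 'rV[R]_0).

Let lebesgue_rV_ex d : exists mu : {sigma_finite_measure set 'rV[R]_d -> \bar R},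
  mu = @lebesgue_rV d :> (set 'rV[R]_d -> \bar R).
Proof.
elim: d => [|d [mu muE]]; first by exists (dirac (0 : 'rV[R]_0)).
pose m : {measure set 'rV[R]_d.+1 -> \bar R} :=
  measure_function_pushforward__canonical__measure_function_Measure
    (@lebesgue_measure R \x mu)%E (@measurable_cons_rV d).
have sm : sigma_finite setT m.
  have /sigma_finiteP[F [FT ndF Foo]] := sigma_finiteT (@lebesgue_measure R).
  have /sigma_finiteP[G [GT ndG Goo]] := sigma_finiteT mu.
  exists (fun n => @uncons_rV d @^-1` (F n `*` G n)).
    apply/seteqP; split => // x _.
    have [i _ Fi] : (\bigcup_i F i) (uncons_rV x).1 by rewrite -FT.
    have [j _ Gj] : (\bigcup_i G i) (uncons_rV x).2 by rewrite -GT.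
    exists (maxn i j) => //; split.
      by move: Fi; exact/subsetPset/ndF/leq_maxl.
    by move: Gj; exact/subsetPset/ndG/leq_maxr.
  move=> n; have [mF Fn] := Foo n; have [mG Gn] := Goo n; split.
    rewrite -[X in measurable X]setTI; apply: measurable_uncons_rV => //.
    exact: measurableX.
  rewrite /m/= /pushforward -comp_preimage (_ : _ \o _ = id); last first.
    by apply/funext => p /=; rewrite cons_rVK.
  rewrite preimage_id product_measure1E//.
  by rewrite lte_mul_pinfty// ge0_fin_numE.
by exists (measure_sigma_finite sm); rewrite /= -muE.
Qed.

Let lebesgue_rV0 d : @lebesgue_rV d set0 = 0%E.
Proof. by have [mu <-] := lebesgue_rV_ex d; exact: measure0. Qed.

Let lebesgue_rV_ge0 d A : (0 <= @lebesgue_rV d A)%E.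
Proof. by have [mu <-] := lebesgue_rV_ex d; exact: measure_ge0. Qed.

Let lebesgue_rV_semi_sigma_additive d : semi_sigma_additive (@lebesgue_rV d).
Proof.
by have [mu <-] := lebesgue_rV_ex d; exact: measure_semi_sigma_additive.
Qed.

HB.instance Definition _ d := isMeasure.Build _ _ _ (@lebesgue_rV d)
  (@lebesgue_rV0 d) (@lebesgue_rV_ge0 d) (@lebesgue_rV_semi_sigma_additive d).

Let lebesgue_rV_sigma_finite d : sigma_finite setT (@lebesgue_rV d).
Proof. by have [mu <-] := lebesgue_rV_ex d; exact: sigma_finiteT. Qed.

HB.instance Definition _ d := Measure_isSigmaFinite.Build _ _ _
  (@lebesgue_rV d) (@lebesgue_rV_sigma_finite d).

Lemma lebesgue_rV_box d (a b : 'rV[R]_d) : (forall i, a 0 i <= b 0 i) ->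
  lebesgue_rV [set x : 'rV[R]_d | forall i, x 0 i \in `[a 0 i, b 0 i]] =
  (\prod_i (b 0 i - a 0 i))%:E.
Proof.
elim: d a b => [|d IH] a b ab.
  by rewrite big_ord0 /= diracE mem_set// => -[].
rewrite big_ord_recl [LHS]/= /pushforward.
pose a' := (uncons_rV a).2; pose b' := (uncons_rV b).2.
rewrite (_ : _ @^-1` _ = [set` `[a 0 0, b 0 0]] `*`
    [set x : 'rV[R]_d | forall i, x 0 i \in `[a' 0 i, b' 0 i]]); last first.
  apply/seteqP; split => p /=.
    move=> h; split; first by rewrite -cons_rV0; exact: h.
    by move=> i; rewrite !mxE -cons_rV_lift; exact: h.
  move=> [h0 h] i; case: (unliftP 0 i) => [j|] ->; last by rewrite cons_rV0.
  by rewrite cons_rV_lift; have := h j; rewrite !mxE.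
rewrite product_measure1E//=; last first.
  rewrite (_ : [set _ | _] = \bigcap_(i in [set: 'I_d])
    [set x : 'rV[R]_d | x 0 i \in `[a' 0 i, b' 0 i]]); last first.
    by apply/seteqP; split => [t h i _|t h i]; exact: h.
  apply: fin_bigcap_measurable => // i _.
  have := @measurable_coord_rV R d i measurableT `[a' 0 i, b' 0 i]%classic.
  by rewrite setTI; apply; exact: measurable_itv.
rewrite lebesgue_measure_itv/= lte_fin IH => [|i]; last by rewrite !mxE.
rewrite (eq_bigr (fun i => b 0 (lift 0 i) - a 0 (lift 0 i))); last first.
  by move=> i _; rewrite !mxE.
have := ab 0; rewrite le_eqVlt => /predU1P[ab0|->]; last by rewrite -EFinB -EFinM.
by rewrite ab0 ltxx subrr mul0r mul0e.
Qed.

End lebesgue_rV.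

Section euclidean_calculus.
Variables (R : realType) (d : nat).
Implicit Types (f V : 'rV[R]_d -> R) (x u v : 'rV[R]_d).

Definition enorm v : R := Num.sqrt (\sum_i v 0 i ^+ 2).

Definition partial (i : 'I_d) f : 'rV[R]_d -> R := 'D_(delta_mx 0 i) f.

(* C^oo: partial derivatives of all orders exist and are continuous; [s] lists
   the directions, the last one being differentiated first. *)
Definition smooth f : Prop :=
  forall s : seq 'I_d, let g := foldr partial f s in
    continuous g /\ forall i x, derivable g x (delta_mx 0 i).

Definition gradient f x : 'rV[R]_d := \row_i partial i f x.

Definition hessian f x : 'M[R]_d := \matrix_(i, j) partial i (partial j f) x.

Definition loewner_le (A B : 'M[R]_d) : Prop :=
  forall u, (u *m A *m u^T) 0 0 <= (u *m B *m u^T) 0 0.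

End euclidean_calculus.

Section gibbs_and_entropy.
Variables (R : realType) (d : nat).
Implicit Types (f V : 'rV[R]_d -> R) (v : 'rV[R]_d).
Local Open Scope ereal_scope.

(* pi is proportional to exp(-V) w.r.t. the Lebesgue measure; as
   [pi setT = 1], the constant c is the inverse of the (finite, positive)
   integral of exp(-V). *)
Definition gibbs V (pi : probability 'rV[R]_d R) : Prop :=
  exists c : R, (0 < c)%R /\ forall A, measurable A ->
    pi A = c%:E * \int[@lebesgue_rV R d]_(x in A) (expR (- V x))%:E.

Definition ent (pi : probability 'rV[R]_d R) f : \bar R :=
  'E_pi[fun x => (f x * ln (f x))%R] - 'E_pi[f] * lne 'E_pi[f].

Definition expectation_rV (pi : probability 'rV[R]_d R)
    (g : 'rV[R]_d -> 'rV[R]_d) : 'rV[R]_d :=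
  \row_i fine 'E_pi[fun x => g x 0%R i].

(* The law of X + v for X of law pi, that is pi * delta_v. *)
Definition translate (pi : probability 'rV[R]_d R) v :
    set 'rV[R]_d -> \bar R :=
  pushforward pi (fun x : 'rV[R]_d => x + v)%R.

Section translate_probability.
Variables (pi : probability 'rV[R]_d R) (v : 'rV[R]_d).

Let translate0 : translate pi v set0 = 0.
Proof. by rewrite /translate /pushforward preimage_set0 measure0. Qed.

Let translate_ge0 A : 0 <= translate pi v A.
Proof. by rewrite /translate /pushforward. Qed.

Let translate_semi_sigma_additive : semi_sigma_additive (translate pi v).
Proof.
exact: (@measure_semi_sigma_additive _ _ _
  (measure_function_pushforward__canonical__measure_function_Measure
    pi (@measurable_shift_rV R d v))).
Qed.

HB.instance Definition _ := isMeasure.Build _ _ _ (translate pi v)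
  translate0 translate_ge0 translate_semi_sigma_additive.

Let translateT : translate pi v setT = 1.
Proof. by rewrite /translate /pushforward preimage_setT probability_setT. Qed.

HB.instance Definition _ :=
  Measure_isProbability.Build _ _ _ (translate pi v) translateT.

End translate_probability.

End gibbs_and_entropy.

Section divergences.
Context (disp : measure_display) (T : measurableType disp) (R : realType).
Implicit Types mu nu : probability T R.
Local Open Scope ereal_scope.
Local Open Scope charge_scope.

Definition density mu nu : T -> \bar R :=
  'd (charge_of_finite_measure mu) '/d nu.

Definition renyi (q : R) mu nu : \bar R :=
  if `[< mu `<< nu >]
  then ((q - 1)^-1)%:E * lne (\int[nu]_x (density mu nu x) `^ q)
  else +oo.

(* In [\bar R], [0 * lne 0 = 0 * -oo = 0]: the usual convention for
   [0 log 0]. *)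
Definition KL mu nu : \bar R :=
  if `[< mu `<< nu >]
  then \int[nu]_x (density mu nu x * lne (density mu nu x))
  else +oo.

End divergences.

(* Main.v *)
Require Import Defs.
From mathcomp Require Import all_boot all_order all_algebra.
From mathcomp Require Import all_classical all_reals all_analysis.
From mathcomp Require Import measurable_realfun ring lra.
Import Order.TTheory GRing.Theory Num.Theory.
Import numFieldNormedType.Exports.
Local Open Scope classical_set_scope.
Local Open Scope ring_scope.

(** The translate of [pi] by [v] has density
    [rho v x = expR (V x - V (x - v))] with respect to [pi], and everything
    follows from moments of this density.

    The upper bound on the Hessian says that [V - beta * enorm ^+ 2 / 2] is
    concave. Since [x - v] is the convex combination of [x - q *: v] and [x]
    with weights [1 / q] and [1 - 1 / q], this yields the pointwise bound
    [rho v x `^ q <= expR (beta * q * (q - 1) * enorm v ^+ 2 / 2) * rho (q *: v) x]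
    ([semiconcave_shift]). As [rho (q *: v)] has integral one, it follows that
    [E rho^q <= expR (beta * q * (q - 1) * enorm v ^+ 2 / 2)]
    ([shift_density_moment]), which is the reverse Renyi transport inequality.
    Hoelder's inequality then gives the shift Harnack inequality, because the
    expectation of [f (x + v)] is that of [f * rho v].

    The other three inequalities use the duality between entropy and
    log-Laplace transform ([entropy_variational]): for a positive [y] of mean
    [m], [E (y * w) <= E (y * ln y) - m * ln m + m * ln E (expR w)].
    With [y = rho v] and [w = q * ln (rho v)], where [q] decreases to [1], it
    gives the reverse KL transport inequality; with [y = rho v] and [w = f], the
    shift log-Harnack inequality. With [y = f] and [w] the inner product of the
    gradient of [V] with a vector [u], it gives the gradient-entropy bound: on
    the one hand, integration by parts turns [E (f * w)] into the inner product
    of the expected gradient of [f] with [u]; on the other hand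
    [w x <= V x - V (x - u) + beta * enorm u ^+ 2 / 2], that is
    [expR (w x) <= expR (beta * enorm u ^+ 2 / 2) * rho u x], so that
    [ln E (expR w) <= beta * enorm u ^+ 2 / 2] ([exp_gradient_moment]). The
    choice of [u] is then optimized.

    Integration by parts needs neither cut-offs nor decay at infinity: the
    integral of a derivative vanishes because the Lebesgue measure is
    invariant by translation ([integral_is_derive_eq0]). *)

Set Implicit Arguments.
Unset Strict Implicit.
Unset Printing Implicit Defensive.

(** * Directional derivatives and semiconcavity *)

Section directional_derivatives.
Context {R : realType} {W : normedModType R}.
Implicit Types (f : W -> R) (x u v : W).

(** The quotients defining both derivatives are the same function. *)
Lemma is_derive_alongP f x v df (t : R) :
  is_derive t 1 (fun s : R => f (x + s *: v)) df <->
  is_derive (x + t *: v) v f df.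
Proof.
have E : (fun h => h^-1 *: ((f \o shift (x + t *: v)) (h *: v) - f (x + t *: v)))
  = (fun h : R => h^-1 *: (((fun s : R => f (x + s *: v)) \o shift t) (h *: 1)
      - f (x + t *: v))).
  apply/funext => h /=; congr (_ *: (f _ - _)).
  by rewrite [h%:A]mulr1 scalerDl addrCA.
split=> -[ex val]; apply: DeriveDef.
- by rewrite /derivable E.
- by rewrite -val /derive E.
- by rewrite /derivable -E.
- by rewrite -val /derive -E.
Qed.

Lemma is_derive_along f x v df (t : R) :
  is_derive (x + t *: v) v f df ->
  is_derive t 1 (fun s : R => f (x + s *: v)) df.
Proof. by move=> /is_derive_alongP. Qed.

Lemma mean_value_along f x v (c : R) : (forall y, derivable f y v) ->
  exists2 t : R, `|t| <= `|c| & f (x + c *: v) - f x = c * 'D_v f (x + t *: v).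
Proof.
move=> df.
have df1 (t : R) : is_derive t 1 (fun s : R => f (x + s *: v))
    ('D_v f (x + t *: v)).
  exact/is_derive_along/derivableP.
have cf (a b : R) : {within `[a, b], continuous (fun s : R => f (x + s *: v))}.
  apply: derivable_within_continuous => t _.
  exact: ex_derive.
have [c0|c0] := leP 0 c.
  have [t] := MVT_segment c0 (fun t _ => df1 t) (cf _ _).
  rewrite in_itv/= => /andP[t0 tc]; rewrite scale0r addr0 subr0 mulrC => E.
  by exists t => //; rewrite !ger0_norm.
have [t] := MVT_segment (ltW c0) (fun t _ => df1 t) (cf _ _).
rewrite in_itv/= => /andP[t0 tc]; rewrite scale0r addr0 => E.
exists t; first by rewrite !ler0_norm// ?lerN2// ltW.
by rewrite -opprB E sub0r mulrN opprK mulrC.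
Qed.

(** Differentiability in the direction [u] at one point, together with a
    continuous derivative in the direction [v], gives differentiability in the
    direction [u + c *: v]: the increment along [v] is controlled by the mean
    value theorem. *)
Lemma is_derive_addv f x u v (a c : R) : is_derive x u f a ->
  (forall y, derivable f y v) -> {for x, continuous ('D_v f)} ->
  is_derive x (u + c *: v) f (a + c * 'D_v f x).
Proof.
move=> [exu valu] dv cv.
suff cvg_quotient :
    h^-1 *: ((f \o shift x) (h *: (u + c *: v)) - f x) @[h --> 0^']
      --> (a + c * 'D_v f x : R).
  by apply: DeriveDef; [apply/cvg_ex; eexists; exact: cvg_quotient|exact/cvg_lim].
have cvgu : h^-1 *: ((f \o shift x) (h *: u) - f x) @[h --> 0^'] --> (a : R).
  by rewrite -valu.
have cvgv : h^-1 *: (f (x + h *: u + (h * c) *: v) - f (x + h *: u))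
    @[h --> 0^'] --> (c * 'D_v f x : R).
  apply/cvgrPdist_le => e e0.
  pose e' := e / (`|c| + 1).
  have c10 : 0 < `|c| + 1 by rewrite ltr_wpDl.
  have e'0 : 0 < e' by rewrite divr_gt0.
  have /cvgrPdist_le/(_ _ e'0) := cv.
  move=> /nbhs_normP[r /= r0 xr].
  pose K := `|u| + `|c| * `|v| + 1.
  have K0 : 0 < K by rewrite ltr_wpDl// addr_ge0// mulr_ge0.
  (* |h| K bounds the distance from x to every point of the broken path
     through x, x + h u and x + h u + h c v *)
  near=> h.
  have h0 : h != 0 by near: h; exact: nbhs_dnbhs_neq.
  have [t tc ->] := mean_value_along (x + h *: u) (h * c) dv.
  rewrite -mulrA [X in _ - X]mulKf// -mulrBr normrM.
  apply: (@le_trans _ _ (`|c| * e')); last first.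
    rewrite /e' mulrCA ler_piMr ?(ltW e0)//.
    by rewrite ler_pdivrMr// mul1r lerDl.
  apply: ler_wpM2l => //; apply: xr.
  rewrite /ball_/= -addrA opprD addNKr normrN.
  apply: (@le_lt_trans _ _ (`|h| * K)).
    apply: (le_trans (ler_normD _ _)).
    rewrite !normrZ /K !mulrDr mulr1 -addrA lerD2l.
    rewrite (@le_trans _ _ (`|h * c| * `|v|))// ?ler_wpM2r//.
    by rewrite normrM -mulrA lerDl.
  rewrite -ltr_pdivlMr//.
  near: h; apply: dnbhs0_lt; exact: divr_gt0.
apply: cvg_trans (cvgD cvgu cvgv); apply: near_eq_cvg; near=> h.
rewrite [LHS]/= -[LHS]scalerDr; congr (_ *: _).
by rewrite [h *: u + x]addrC /= scalerDr scalerA [_ + x]addrC (addrA x); ring.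
Unshelve. all: by end_near.
Qed.

End directional_derivatives.

Section taylor.
Context {R : realType} {d : nat}.
Implicit Types (f V : 'rV[R]_d -> R) (x u v : 'rV[R]_d).

(** Continuous functions whose partial derivatives exist and are continuous. *)
Definition C1 f : Prop := continuous f /\
  forall i, continuous (partial i f) /\
            forall x, derivable f x (delta_mx 0 i).

(** The chain rule along lines: one coordinate direction is added at a time. *)
Lemma is_derive_C1 f x u : C1 f ->
  is_derive x u f (\sum_i u 0 i * partial i f x).
Proof.
move=> [_ C1f]; rewrite [X in is_derive _ X](row_sum_delta u).
elim: (index_enum 'I_d) => [|i s IH]; first by rewrite !big_nil; exact: is_derive0.
rewrite !big_cons addrC [X in is_derive _ _ _ X]addrC.
by apply: is_derive_addv => //; case: (C1f i) => // ci _; exact: ci.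
Qed.

Lemma smooth_C1 f : smooth f -> C1 f.
Proof.
move=> sf; split; first by have [] := sf [::].
by move=> i; split; [have [] := sf [:: i]|have [] := sf [::]].
Qed.

Lemma smooth_partial f i : smooth f -> smooth (partial i f).
Proof. by move=> sf s; have := sf (rcons s i); rewrite foldr_rcons. Qed.

Lemma sqr_enorm v : enorm v ^+ 2 = \sum_i v 0 i ^+ 2.
Proof. by rewrite sqr_sqrtr// sumr_ge0// => i _; rewrite sqr_ge0. Qed.

(** The Euclidean inner product. *)
Definition dotv u v : R := \sum_i u 0 i * v 0 i.

Lemma dotvN u v : dotv u (- v) = - dotv u v.
Proof. by rewrite /dotv -sumrN; apply: eq_bigr => i _; rewrite mxE mulrN. Qed.

Lemma enormN v : enorm (- v) = enorm v.
Proof.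
by rewrite /enorm; congr Num.sqrt; apply: eq_bigr => i _; rewrite mxE sqrrN.
Qed.

(** A Hessian bounded above by [beta] bounds [V] above by its first-order
    expansion plus a quadratic term: on the line [t |-> x + t *: w] the second
    derivative is at most [beta * enorm w ^+ 2], and the mean value theorem is
    applied twice. *)
Lemma taylor_hessian_le (beta : R) V : smooth V ->
  (forall x, loewner_le (hessian V x) (beta%:M)) ->
  forall x w, V (x + w) <=
    V x + dotv (gradient V x) w + beta * enorm w ^+ 2 / 2.
Proof.
move=> sV hV x w.
(* the first two derivatives of t |-> V (x + t w) *)
pose D t := \sum_i w 0 i * partial i V (x + t *: w).
pose D2 t := \sum_i w 0 i * \sum_j w 0 j * partial j (partial i V) (x + t *: w).
have dV (t : R) : is_derive t 1 (fun s : R => V (x + s *: w)) (D t).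
  exact/is_derive_along/is_derive_C1/smooth_C1.
have dD (t : R) : is_derive t 1 D (D2 t).
  apply: (@is_derive_eq _ _ _ _ _ _ _ (\sum_i w 0 i *:
      \sum_j w 0 j * partial j (partial i V) (x + t *: w))); last by [].
  rewrite (_ : D = \sum_i (w 0 i \*: (fun s : R => partial i V (x + s *: w))));
    last by apply/funext => s; rewrite fct_sumE.
  apply: is_derive_sum => i; apply: is_deriveZ.
  exact/is_derive_along/is_derive_C1/smooth_C1/smooth_partial.
have D2le t : D2 t <= beta * enorm w ^+ 2.
  have := hV (x + t *: w) w.
  rewrite [X in X <= _ -> _](_ : _ = D2 t); last first.
    rewrite mxE /D2; apply: eq_bigr => i _.
    rewrite !mxE mulrC; congr (_ * _); apply: eq_bigr => j _.
    by rewrite !mxE.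
  rewrite [X in _ <= X -> _](_ : _ = beta * enorm w ^+ 2)//.
  rewrite mul_mx_scalar -scalemxAl !mxE sqr_enorm; congr (_ * _).
  by apply: eq_bigr => i _; rewrite !mxE expr2.
have contW (g dg : R -> R) (a b : R) : (forall t : R, is_derive t 1 g (dg t)) ->
    {within `[a, b], continuous g}.
  by move=> dg'; apply: derivable_within_continuous => t _; exact: ex_derive.
have Dle t : 0 <= t -> D t <= D 0 + beta * enorm w ^+ 2 * t.
  move=> t0; have [s _] := MVT_segment t0 (fun s _ => dD s) (contW _ _ _ _ dD).
  rewrite subr0 => E; rewrite -lerBlDl E.
  by rewrite ler_wpM2r.
(* g has nonpositive derivative dg on [0, 1], and g 1 <= g 0 is the claim *)
pose g t := V (x + t *: w) - (D 0 * t + beta * enorm w ^+ 2 / 2 * t ^+ 2).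
pose dg t := D t - (D 0 + beta * enorm w ^+ 2 * t).
have gdg (t : R) : is_derive t 1 g (dg t).
  rewrite /g /dg.
  apply: is_deriveB.
  apply: is_derive_eq.
  by rewrite /GRing.scale/=; field.
have [t] := MVT_segment ler01 (fun t _ => gdg t) (contW _ _ _ _ gdg).
rewrite in_itv/= => /andP[t0 _] E.
have : dg t <= 0 by rewrite /dg subr_le0 Dle.
move: E; rewrite subr0 mulr1 => <-.
rewrite /g scale1r scale0r addr0 !mulr0 expr1n !mulr1 expr0n/= mulr0 addr0 subr0.
rewrite [dotv _ _](_ : _ = D 0); first by lra.
by apply: eq_bigr => i _; rewrite scale0r addr0 mxE mulrC.
Qed.

(** Since [x - v] is the convex combination of [x - q *: v] and [x] with
    weights [1 / q] and [1 - 1 / q], this is the concavity of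
    [V - beta * enorm ^+ 2 / 2] there, multiplied by [q]. *)
Lemma semiconcave_shift (beta : R) V : smooth V ->
  (forall x, loewner_le (hessian V x) (beta%:M)) ->
  forall (q : R) x v, 1 <= q ->
  V (x - q *: v) + (q - 1) * V x <=
    q * V (x - v) + beta * q * (q - 1) * enorm v ^+ 2 / 2.
Proof.
move=> sV hV q x v q1.
have enZ c : enorm (c *: v) ^+ 2 = c ^+ 2 * enorm v ^+ 2.
  rewrite !sqr_enorm mulr_sumr; apply: eq_bigr => i _.
  by rewrite mxE exprMn.
have dZ c : dotv (gradient V (x - v)) (c *: v) = c * dotv (gradient V (x - v)) v.
  by rewrite /dotv mulr_sumr; apply: eq_bigr => i _; rewrite !mxE mulrCA.
have T c := taylor_hessian_le sV hV (x - v) (c *: v).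
(* the two end points are x - v + v and x - v + (1 - q) v *)
have := T 1; have := T (1 - q); rewrite !dZ !enZ scale1r subrK.
rewrite scalerBl scale1r addrA subrK.
set A := V _; set B := V x; set C := V (x - v); set G := dotv _ _.
set E := enorm v ^+ 2 => h1 h2.
have := ler_wpM2l (_ : 0 <= q - 1) h2; rewrite subr_ge0 => /(_ q1); nra.
Qed.

End taylor.

(** * Densities and translation invariance of the Lebesgue measure *)

Section densities.
Context {disp : measure_display} {T : measurableType disp} {R : realType}.
Local Open Scope ereal_scope.
Local Open Scope charge_scope.

(** A function that integrates to [nu] is almost everywhere the
    Radon-Nikodym derivative of [nu]. *)
Lemma density_ae_eq (nu : {finite_measure set T -> \bar R})
    (mu : {sigma_finite_measure set T -> \bar R}) (g : T -> \bar R) :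
  measurable_fun setT g ->
  (forall A, measurable A -> nu A = \int[mu]_(x in A) g x) ->
  nu `<< mu /\ ae_eq mu setT ('d (charge_of_finite_measure nu) '/d mu) g.
Proof.
move=> mg nuE.
have numu : nu `<< mu.
  apply/null_content_dominatesP => A mA muA0.
  rewrite nuE//; apply: null_set_integral => //.
  exact: measurable_funTS.
split => //; apply: integral_ae_eq => //.
  exact: Radon_Nikodym_integrable.
by move=> A _ mA; rewrite -Radon_Nikodym_integral// -nuE.
Qed.

Lemma ge0_integral_density (nu : {finite_measure set T -> \bar R})
    (mu : {sigma_finite_measure set T -> \bar R}) (g : T -> \bar R) :
  measurable_fun setT g -> (forall x, 0 <= g x) ->
  (forall A, measurable A -> nu A = \int[mu]_(x in A) g x) ->
  forall f : T -> \bar R, measurable_fun setT f -> (forall x, 0 <= f x) ->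
  \int[nu]_x f x = \int[mu]_x (f x * g x).
Proof.
move=> mg g0 nuE f mf f0.
have [numu gE] := density_ae_eq mg nuE.
rewrite -(Radon_Nikodym_SigmaFinite.change_of_variables numu)//.
apply: ge0_ae_eq_integral => //.
- apply: emeasurable_funM => //.
  apply: measurable_int; exact: Radon_Nikodym_SigmaFinite.f_integrable.
- exact: emeasurable_funM.
- by move=> x _; rewrite mule_ge0// Radon_Nikodym_SigmaFinite.f_ge0.
- by move=> x _; rewrite mule_ge0.
have h := @ae_eq_Radon_Nikodym_SigmaFinite _ _ _ nu mu numu _ measurableT.
by apply: filterS2 h gE => x /(_ I) + /(_ I) <- => ->.
Qed.

End densities.

Section translation_invariance.
Context {R : realType}.
Local Open Scope ereal_scope.

Lemma lebesgue_measure_shift (s : R) (A : set R) : measurable A ->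
  lebesgue_measure ((fun x : R => x + s)%R @^-1` A) = lebesgue_measure A.
Proof.
have ms : measurable_fun (setT : set (measurableTypeR R))
    ((fun x => x + s)%R : _ -> measurableTypeR R).
  exact: (@measurable_funD _ R R setT id (cst s)).
pose m : {measure set (measurableTypeR R) -> \bar R} :=
  measure_function_pushforward__canonical__measure_function_Measure
    (@lebesgue_measure R) ms.
move=> mA; apply/esym; apply: (@lebesgue_measure_unique R m) => // X.
move=> [[a b] /= _ <-].
rewrite /m/= /pushforward.
rewrite (_ : _ @^-1` _ = `]a - s, b - s]%classic)%R; last first.
  by apply/seteqP; split => x; rewrite /= !in_itv/= ltrBlDr lerBrDr.
by rewrite !lebesgue_measure_itv/= !lte_fin ltrD2r -!EFinD; case: ifPn => // _;
  congr EFin; ring.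
Qed.

Lemma ge0_integral_lebesgue_shift (s : R) (f : R -> \bar R) :
  measurable_fun setT f -> (forall x, 0 <= f x) ->
  \int[lebesgue_measure]_x f (x + s)%R = \int[lebesgue_measure]_x f x.
Proof.
move=> mf f0.
have ms : measurable_fun (setT : set (measurableTypeR R))
    ((fun x => x + s)%R : _ -> measurableTypeR R).
  exact: (@measurable_funD _ R R setT id (cst s)).
rewrite -[LHS](@ge0_integral_pushforward _ _ (measurableTypeR R)
  (measurableTypeR R) R _ ms (@lebesgue_measure R) setT f)//.
by apply: eq_measure_integral => A mA _; exact: lebesgue_measure_shift.
Qed.

(** Translation invariance by induction on the dimension: the first coordinate
    of the shift acts on the one-dimensional integral, the others act on the
    sections. *)
Lemma lebesgue_rV_shift d (v : 'rV[R]_d) (A : set 'rV[R]_d) : measurable A ->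
  lebesgue_rV ((fun x : 'rV[R]_d => x + v)%R @^-1` A) = lebesgue_rV A.
Proof.
elim: d v A => [|d IH] v A mA.
  rewrite (_ : _ @^-1` _ = A)//; apply/seteqP.
  by split => x /=; rewrite (thinmx0 v) addr0.
rewrite /= /pushforward /product_measure1.
pose B := @cons_rV R d @^-1` A.
have mB : measurable B.
  by rewrite -[B]setTI; exact: measurable_cons_rV.
pose w := (uncons_rV v).2.
transitivity (\int[lebesgue_measure]_x
    (@lebesgue_rV R d \o xsection B) (x + v 0 0)%R); last first.
  apply: (@ge0_integral_lebesgue_shift (v 0 0)%R (@lebesgue_rV R d \o xsection B)).
    exact: measurable_fun_xsection.
  by move=> x /=.
apply: eq_integral => x _ /=.
rewrite -(IH w (xsection B (x + v 0 0)%R)); last exact: measurable_xsection.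
congr (lebesgue_rV _); apply/seteqP.
have E y : (cons_rV (x, y) + v = cons_rV (x + v 0 0, y + w))%R.
  apply/rowP => i; rewrite mxE; case: (unliftP 0%R i) => [j|] ->.
    by rewrite !cons_rV_lift/= !mxE.
  by rewrite !cons_rV0.
by split => y /=; rewrite /xsection /B /= !inE /= E.
Qed.

Lemma ge0_integral_lebesgue_rV_shift d (v : 'rV[R]_d) (f : 'rV[R]_d -> \bar R) :
  measurable_fun setT f -> (forall x, 0 <= f x) ->
  \int[@lebesgue_rV R d]_x f (x + v)%R = \int[@lebesgue_rV R d]_x f x.
Proof.
move=> mf f0.
have ms : measurable_fun setT (fun x : 'rV[R]_d => x + v)%R.
  exact: measurable_shift_rV.
rewrite -[LHS](@ge0_integral_pushforward _ _ _ _ _ _ ms (@lebesgue_rV R d)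
  setT f)//.
by apply: eq_measure_integral => A mA _; exact: lebesgue_rV_shift.
Qed.

Lemma integral_lebesgue_rV_shift d (v : 'rV[R]_d) (f : 'rV[R]_d -> \bar R) :
  measurable_fun setT f ->
  \int[@lebesgue_rV R d]_x f (x + v)%R = \int[@lebesgue_rV R d]_x f x.
Proof.
move=> mf; rewrite integralE [RHS]integralE; congr (_ - _).
  rewrite -(@ge0_integral_lebesgue_rV_shift d v (f^\+)) //.
    by apply: eq_integral => x _; rewrite unlock.
  exact: measurable_funepos.
rewrite -(@ge0_integral_lebesgue_rV_shift d v (f^\-)) //.
  by apply: eq_integral => x _; rewrite unlock.
exact: measurable_funeneg.
Qed.

End translation_invariance.

(** * Entropy duality *)

Section entropy.
Context {disp : measure_display} {T : measurableType disp} {R : realType}.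
Variable P : probability T R.
Implicit Types f g y w : T -> R.

(** Integrability of a real-valued function. *)
Local Notation L1 f := (P.-integrable setT (EFin \o f)).

Lemma integrable_dominated f g : measurable_fun setT f ->
  (forall x, `|f x| <= g x) -> L1 g -> L1 f.
Proof.
move=> mf fg; apply: le_integrable => //; first exact/measurable_EFinP.
move=> x _ /=; rewrite lee_fin (le_trans (fg x))//.
exact: ler_norm.
Qed.

Lemma ge0_integrable_lty f : measurable_fun setT f -> (forall x, 0 <= f x) ->
  (\int[P]_x (f x)%:E < +oo)%E -> L1 f.
Proof.
move=> mf f0 foo; apply/integrableP; split; first exact/measurable_EFinP.
by under eq_integral do rewrite /= ger0_norm//.
Qed.

Lemma Rintegral_gt0 f : L1 f -> (forall x, 0 < f x) -> 0 < \int[P]_x f x.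
Proof.
move=> f1 f0; rewrite lt_neqAle Rintegral_ge0 ?andbT; last by move=> x _; exact: ltW.
apply/negP => /eqP/esym I0.
have mf : measurable_fun setT (EFin \o f) by exact: measurable_int f1.
have : (\int[P]_x `|(EFin \o f) x| = 0)%E.
  under eq_integral do rewrite /= gtr0_norm//.
  by rewrite -(fineK (integrable_fin_num measurableT f1)) -/(Rintegral _ _ _) I0.
move/(ae_eq_integral_abs _ measurableT mf) => [N [mN N0 subN]].
have : P setT = 0%E.
  apply: (subset_measure0 _ _ _ N0) => //.
  by move=> x _; apply: subN => /= /(_ I) [] /eqP; rewrite gt_eqF.
by rewrite probability_setT => /eqP; rewrite onee_eq0.
Qed.

(** Young's inequality for the conjugate pair [a * ln a - a] and [expR b]. *)
Lemma young_entropy (a b : R) : 0 < a -> a * b <= a * ln a - a + expR b.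
Proof.
move=> a0; have := ler_wpM2l (ltW a0) (expR_ge1Dx (b - ln a)).
by rewrite expRB lnK// [_ / a]mulrC mulVKf ?gt_eqF//; lra.
Qed.

(** Both exponential moments are needed because [w] has no sign. *)
Lemma integrable_entropyM y w : measurable_fun setT y -> measurable_fun setT w ->
  (forall x, 0 < y x) -> L1 (fun x => y x * ln (y x)) ->
  L1 (fun x => expR (w x)) -> L1 (fun x => expR (- w x)) ->
  L1 (fun x => y x * w x).
Proof.
move=> my mw y0 iy iw iNw.
apply: (@integrable_dominated _
    (fun x => `|y x * ln (y x)| + (expR (w x) + expR (- w x)))).
- exact: measurable_funM.
- move=> x; rewrite normrM gtr0_norm//.
  apply: (le_trans (young_entropy _ (y0 x))).
  rewrite lerD//; first by rewrite lerBlDr (le_trans (ler_norm _))// lerDl ltW.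
  have [w0|w0] := leP 0 (w x); first by rewrite ger0_norm// lerDl expR_ge0.
  by rewrite ltr0_norm// lerDr expR_ge0.
- apply: (@integrableD _ _ _ P setT measurableT
    (EFin \o (fun x => `|y x * ln (y x)|))
    (EFin \o (fun x => expR (w x) + expR (- w x)))).
    exact: (integrable_norm iy).
  exact: (@integrableD _ _ _ P setT measurableT
    (EFin \o (fun x => expR (w x))) (EFin \o (fun x => expR (- w x)))).
Qed.

(** The duality between entropy and log-Laplace transform: the entropy of [y]
    plus [E y] times the log-Laplace transform of [w] dominates the integral
    of [y * w]. *)
Lemma entropy_variational y w : (forall x, 0 < y x) ->
  L1 y -> L1 (fun x => y x * ln (y x)) ->
  L1 (fun x => y x * w x) -> L1 (fun x => expR (w x)) ->
  \int[P]_x (y x * w x) <= \int[P]_x (y x * ln (y x))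
    - (\int[P]_x y x) * ln (\int[P]_x y x)
    + (\int[P]_x y x) * ln (\int[P]_x expR (w x)).
Proof.
move=> y0 iy iylny iyw iexp.
set m := \int[P]_x y x; set M := \int[P]_x expR (w x).
have m0 : 0 < m by exact: Rintegral_gt0.
have M0 : 0 < M by apply: Rintegral_gt0 => // x; exact: expR_gt0.
(* with this shift the integral of expR (w - c) equals m *)
pose c := ln M - ln m.
have expc : expR (- c) = m / M by rewrite /c opprB expRB !lnK.
have icy : L1 (fun x => c * y x) by exact: (integrableZl _ c iy).
have iexpc : L1 (fun x => m / M * expR (w x)).
  exact: (integrableZl _ (m / M) iexp).
have iA : L1 (fun x => y x * ln (y x) - y x).
  exact: (@integrableB _ _ _ P setT measurableT
    (EFin \o (fun x => y x * ln (y x))) (EFin \o y)).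
have : \int[P]_x (y x * w x - c * y x) <=
    \int[P]_x ((y x * ln (y x) - y x) + m / M * expR (w x)).
  apply: le_Rintegral => //.
  - exact: (@integrableB _ _ _ P setT measurableT
      (EFin \o (fun x => y x * w x)) (EFin \o (fun x => c * y x))).
  - exact: (@integrableD _ _ _ P setT measurableT
      (EFin \o (fun x => y x * ln (y x) - y x))
      (EFin \o (fun x => m / M * expR (w x)))).
  - move=> x _; rewrite -expc -expRD [- c + _]addrC.
    by have := young_entropy (w x - c) (y0 x); lra.
rewrite RintegralB// RintegralD// RintegralB// !RintegralZl// -/m -/M.
by rewrite divfK ?gt_eqF// /c; lra.
Qed.

End entropy.

(** * Translates of a Gibbs measure *)

Section gibbs_translation.
Context {R : realType} {d : nat}.
Variables (V : 'rV[R]_d -> R) (pi : probability 'rV[R]_d R).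
Hypotheses (Vcont : continuous V) (piV : gibbs V pi).
Implicit Types (v x : 'rV[R]_d).
Local Open Scope ereal_scope.

Let measurableV : measurable_fun setT V.
Proof. exact: continuous_measurable_rV. Qed.

Lemma ge0_integral_gibbs : exists2 c : R, (0 < c)%R &
  forall f : 'rV[R]_d -> \bar R, measurable_fun setT f ->
    (forall x, 0 <= f x) ->
    \int[pi]_x f x = c%:E * \int[@lebesgue_rV R d]_x (f x * (expR (- V x))%:E).
Proof.
have [c [c0 piE]] := piV; exists c => // f mf f0.
have mexp : measurable_fun setT (fun x => (expR (- V x))%:E).
  by apply/measurable_EFinP/measurableT_comp => //; exact: measurableT_comp.
have mcexp : measurable_fun setT (fun x => c%:E * (expR (- V x))%:E).
  exact: measurable_funeM.
have exp0 x : 0 <= (expR (- V x))%:E by rewrite lee_fin expR_ge0.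
have cexp0 x : 0 <= c%:E * (expR (- V x))%:E by rewrite mule_ge0// lee_fin ltW.
rewrite (ge0_integral_density (mu := @lebesgue_rV R d) mcexp cexp0)//.
  rewrite -ge0_integralZl//.
  - by apply: eq_integral => x _; rewrite muleCA.
  - exact: emeasurable_funM.
  - by move=> x _; rewrite mule_ge0.
  - by rewrite lee_fin ltW.
move=> A mA; rewrite [LHS]piE// ge0_integralZl//.
- exact: measurable_funTS.
- by rewrite lee_fin ltW.
Qed.

(** The density of [translate pi v] with respect to [pi]: the normalizing
    constants of the two measures cancel. *)
Definition shift_density v x : R := expR (V x - V (x - v)).

Lemma shift_density_gt0 v x : (0 < shift_density v x)%R.
Proof. exact: expR_gt0. Qed.

Lemma ln_shift_density v x : ln (shift_density v x) = (V x - V (x - v))%R.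
Proof. exact: expRK. Qed.

Lemma measurable_shift_density v : measurable_fun setT (shift_density v).
Proof.
apply: measurableT_comp => //; apply: measurable_funB => //.
by apply: measurableT_comp => //; exact: measurable_shift_rV.
Qed.

(** Change of variables [x |-> x - v] in the Lebesgue integral of
    [f (x + v) * expR (- V x)]. *)
Lemma ge0_integral_shift_density v (f : 'rV[R]_d -> \bar R) :
  measurable_fun setT f -> (forall x, 0 <= f x) ->
  \int[pi]_x f (x + v)%R = \int[pi]_x (f x * (shift_density v x)%:E).
Proof.
move=> mf f0.
have msf : measurable_fun setT (fun x => f (x + v)%R).
  by apply: measurableT_comp => //; exact: measurable_shift_rV.
have mdens : measurable_fun setT (fun x => (shift_density v x)%:E).
  by apply/measurable_EFinP; exact: measurable_shift_density.
have [c c0 piE] := ge0_integral_gibbs.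
rewrite !piE//; last 2 first.
  - exact: emeasurable_funM.
  - by move=> x; rewrite mule_ge0// lee_fin ltW// shift_density_gt0.
congr (_ * _).
pose F x := f x * (expR (- V (x - v)%R))%:E.
rewrite (eq_integral (fun x => F (x + v)%R)); last first.
  by move=> x _; rewrite /F addrK.
rewrite ge0_integral_lebesgue_rV_shift//.
- apply: eq_integral => x _; rewrite /F -muleA -EFinM -expRD.
  by congr (_ * (expR _)%:E); rewrite addrAC subrr add0r.
- apply: emeasurable_funM => //.
  apply/measurable_EFinP/measurableT_comp => //; apply: measurableT_comp => //.
  by apply: measurableT_comp => //; exact: measurable_shift_rV.
- by move=> x; rewrite mule_ge0// lee_fin expR_ge0.
Qed.

Lemma integral_shift_density1 v : \int[pi]_x (shift_density v x)%:E = 1.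
Proof.
transitivity (\int[pi]_x (cst 1 x * (shift_density v x)%:E)).
  by apply: eq_integral => x _; rewrite mul1e.
rewrite -(@ge0_integral_shift_density v (cst 1)) //.
rewrite [LHS](_ : _ = \int[pi]_x (cst 1 x))//.
by rewrite integral_cst// mul1e; exact: probability_setT.
Qed.

Lemma translate_shift_density v A : measurable A ->
  translate pi v A = \int[pi]_(x in A) (shift_density v x)%:E.
Proof.
move=> mA; rewrite /translate /pushforward.
set B := _ @^-1` A.
have mB : measurable B by rewrite -[B]setTI; exact: measurable_shift_rV.
rewrite -[LHS]mul1e -[LHS]integral_cst// [LHS]integral_mkcond [RHS]integral_mkcond.
pose f x : \bar R := (\1_A x)%:E.
transitivity (\int[pi]_x f (x + v)%R).
  apply: eq_integral => x _; rewrite /f patchE indicE.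
  rewrite (_ : (x \in B) = (x + v \in A)%R); first by case: ifP.
  by apply/idP/idP; rewrite !inE.
rewrite ge0_integral_shift_density//.
- apply: eq_integral => x _; rewrite /f patchE indicE.
  by case: ifP; rewrite ?mul1e ?mul0e.
- exact/measurable_EFinP/measurable_indic.
- by move=> x; rewrite lee_fin.
Qed.

Lemma translate_dominated v : translate pi v `<< pi /\
  ae_eq pi setT (density (translate pi v) pi) (fun x => (shift_density v x)%:E).
Proof.
have mrho : measurable_fun setT (fun x => (shift_density v x)%:E).
  apply/measurable_EFinP; exact: measurable_shift_density.
exact: (density_ae_eq (nu := translate pi v) (mu := pi) mrho
  (@translate_shift_density v)).
Qed.

End gibbs_translation.

Section renyi_moment.
Context {R : realType} {d : nat}.
Variables (beta : R) (V : 'rV[R]_d -> R) (pi : probability 'rV[R]_d R).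
Hypotheses (Vsmooth : smooth V) (piV : gibbs V pi).
Hypothesis hessV : forall x, loewner_le (hessian V x) (beta%:M).
Implicit Types (v x : 'rV[R]_d).
Local Open Scope ereal_scope.

Let Vcont : continuous V. Proof. by case: (smooth_C1 Vsmooth). Qed.
Local Notation rho := (shift_density V).

(** The Renyi bound in exponential form. By semiconcavity the [q]-th power of
    the density of the shift by [v] is at most a constant times the density of
    the shift by [q *: v], and the latter integrates to one. *)
Lemma shift_density_moment (q : R) v : (1 <= q)%R ->
  \int[pi]_x (rho v x `^ q)%:E <= (expR (beta * q * (q - 1) * enorm v ^+ 2 / 2))%:E.
Proof.
move=> q1; set C := expR _.
have mrho w : measurable_fun setT (fun x => (rho w x)%:E).
  apply/measurable_EFinP; exact: measurable_shift_density.
apply: (@le_trans _ _ (\int[pi]_x (C%:E * (rho (q *: v)%R x)%:E))).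
  apply: ge0_le_integral => //.
  - by move=> x _; rewrite lee_fin powR_ge0.
  - apply/measurable_EFinP; apply: (measurableT_comp (measurable_powR q)).
    exact: measurable_shift_density.
  - exact: measurable_funeM.
  - move=> x _; rewrite lee_fin /rho -expRM -expRD ler_expR.
    by have := semiconcave_shift Vsmooth hessV x v q1; lra.
rewrite ge0_integralZl//; last 2 first.
- by move=> x _; rewrite lee_fin ltW// shift_density_gt0.
- by rewrite lee_fin expR_ge0.
by rewrite (integral_shift_density1 Vcont piV) mule1.
Qed.

End renyi_moment.

Lemma measurable_lne (R : realType) : measurable_fun [set: \bar R] (@lne R).
Proof.
rewrite (_ : @lne R = fun x : \bar R => (if x <= 0 then -oo
    else if x == +oo then +oo else (ln (fine x))%:E)%E); last first.
  by apply/funext => -[r| |] //=; rewrite leNye.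
rewrite -/(measurable_fun _ _).
apply: measurable_fun_ifT => //=; first exact: measurable_fun_lee.
apply: measurable_fun_ifT => //=; first exact: measurable_fun_eqe.
by apply/measurable_EFinP; exact: measurableT_comp.
Qed.

Section divergence_bounds.
Context {R : realType} {d : nat}.
Variables (beta : R) (V : 'rV[R]_d -> R) (pi : probability 'rV[R]_d R).
Hypotheses (Vsmooth : smooth V) (piV : gibbs V pi).
Hypothesis hessV : forall x, loewner_le (hessian V x) (beta%:M).
Implicit Types (v x : 'rV[R]_d).

Let Vcont : continuous V. Proof. by case: (smooth_C1 Vsmooth). Qed.
Local Notation rho := (shift_density V).
Local Notation L1 f := (pi.-integrable setT (EFin \o f)).

Let mrho v : measurable_fun setT (rho v).
Proof. exact: measurable_shift_density. Qed.

Lemma measurable_shift_density_powR q v :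
  measurable_fun setT (fun x => rho v x `^ q).
Proof. exact: (measurableT_comp (measurable_powR q)). Qed.

Lemma integrable_shift_density v : L1 (rho v).
Proof.
apply: ge0_integrable_lty => // [x|]; first exact: expR_ge0.
by rewrite (integral_shift_density1 Vcont piV) ltry.
Qed.

Lemma Rintegral_shift_density v : \int[pi]_x rho v x = 1.
Proof. by rewrite /Rintegral (integral_shift_density1 Vcont piV). Qed.

Lemma integrable_shift_density_powR q v : 1 <= q -> L1 (fun x => rho v x `^ q).
Proof.
move=> q1; apply: ge0_integrable_lty => // [|x|].
- exact: measurable_shift_density_powR.
- exact: powR_ge0.
- by rewrite (le_lt_trans (shift_density_moment Vsmooth piV hessV v q1))// ltry.
Qed.

Lemma Rintegral_shift_density_powR q v : 1 <= q ->
  \int[pi]_x (rho v x `^ q) <= expR (beta * q * (q - 1) * enorm v ^+ 2 / 2).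
Proof.
move=> q1; rewrite -lee_fin fineK; first exact: shift_density_moment.
exact/integrable_fin_num/integrable_shift_density_powR.
Qed.

Lemma integrable_shift_density_ln v : L1 (fun x => rho v x * ln (rho v x)).
Proof.
(* for r > 0, r ln r <= r ^ 2, and - 1 <= r ln r - r by Young's inequality *)
apply: (@integrable_dominated _ _ _ _ _ (fun x => rho v x `^ 2 + 1)).
- by apply: measurable_funM => //; exact: measurableT_comp.
- move=> x /=; have r0 := shift_density_gt0 V v x.
  rewrite powR_mulrn ?(ltW r0)//; move: (rho v x) r0 => r r0.
  have := young_entropy 0 r0; rewrite mulr0 expR0 => h1.
  have := ln_sublinear r0 => h2.
  rewrite ler_norml; apply/andP; split; first nra.
  nra.
- apply: (@integrableD _ _ _ pi setT measurableT
    (EFin \o (fun x => rho v x `^ 2)) (EFin \o (cst 1))).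
    by apply: integrable_shift_density_powR; rewrite ler1n.
  exact: finite_measure_integrable_cst.
Qed.

(** The entropy [X] of the shift density [r]: duality tested against
    [q * ln r] gives [q * X <= X + ln E r^q], hence [X <= a * q] with
    [a = beta * enorm v ^+ 2 / 2] by the moment bound, for every [q > 1]. *)
Lemma entropy_shift_density v :
  \int[pi]_x (rho v x * ln (rho v x)) <= beta * enorm v ^+ 2 / 2.
Proof.
set X := Rintegral _ _ _; set a := _ / 2.
have Xle q : 1 < q -> X <= a * q.
  move=> q1; have iln := integrable_shift_density_ln v.
  have Eexp x : expR (q * ln (rho v x)) = rho v x `^ q.
    by rewrite ln_shift_density /rho -expRM mulrC.
  have iq := integrable_shift_density_powR v (ltW q1).
  have := @entropy_variational _ _ _ pi (rho v) (fun x => q * ln (rho v x)).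
  rewrite Rintegral_shift_density ln1 mulr0 subr0 mul1r.
  under [X in _ <= _ + ln X]eq_Rintegral do rewrite Eexp.
  under eq_Rintegral do rewrite mulrCA.
  rewrite RintegralZl// -/X => H.
  have : q * X <= X + ln (\int[pi]_x (rho v x `^ q)).
    apply: H => //.
    - by move=> x; exact: shift_density_gt0.
    - exact: integrable_shift_density.
    - have := integrableZl measurableT q iln.
      by apply: eq_integrable => // x _ /=; rewrite -EFinM mulrCA.
    - by apply: eq_integrable iq => // x _ /=; rewrite Eexp.
  have : ln (\int[pi]_x (rho v x `^ q)) <= beta * q * (q - 1) * enorm v ^+ 2 / 2.
    rewrite -[leRHS]expRK ler_ln ?posrE ?expR_gt0//.
      exact/Rintegral_shift_density_powR/ltW.
    by apply: (Rintegral_gt0 iq) => x; rewrite powR_gt0// shift_density_gt0.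
  move=> h1 h2; rewrite -subr_ge0 -(pmulr_rge0 _ (_ : 0 < q - 1)) ?subr_gt0//.
  by rewrite /a; nra.
(* q tends to 1; the sign of a is not needed *)
apply/ler_addgt0Pr => e e0.
have a1 : 0 < `|a| + 1 by rewrite ltr_wpDl.
have ea : 0 < e / (`|a| + 1) by rewrite divr_gt0.
apply: (le_trans (Xle (1 + e / (`|a| + 1)) _)); first by rewrite ltrDl.
rewrite mulrDr mulr1 lerD2l mulrCA ler_piMr ?(ltW e0)//.
rewrite ler_pdivrMr// mul1r (le_trans (ler_norm _))// lerDl//.
Qed.

Local Open Scope ereal_scope.

Lemma measurable_density v :
  measurable_fun setT (density (translate pi v) pi).
Proof.
have [dom _] := translate_dominated Vcont piV v.
exact/measurable_int/Radon_Nikodym_integrable.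
Qed.

Lemma renyi_translate_le q v : (1 < q)%R ->
  renyi q (translate pi v) pi <= (beta * q * enorm v ^+ 2 / 2)%:E.
Proof.
move=> q1; have [dom densE] := translate_dominated Vcont piV v.
rewrite /renyi asboolT//.
rewrite (ge0_ae_eq_integral (g := fun x => (rho v x `^ q)%:E)) //.
- have h := shift_density_moment Vsmooth piV hessV v (ltW q1).
  have : lne (\int[pi]_x (rho v x `^ q)%:E) <=
      (beta * q * (q - 1) * enorm v ^+ 2 / 2)%:E.
    rewrite -[X in _ <= X%:E]expRK -lne_EFin ?expR_gt0//.
    rewrite lee_lne// in_itv/= leey andbT ?lee_fin ?expR_ge0//.
    by apply: integral_ge0 => x _; rewrite lee_fin powR_ge0.
  move=> h1; apply: (le_trans (lee_wpmul2l _ h1)).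
    by rewrite lee_fin invr_ge0 subr_ge0 ltW.
  rewrite -EFinM lee_fin le_eqVlt; apply/orP; left; apply/eqP.
  by field; rewrite subr_eq0 gt_eqF.
- exact: (measurableT_comp (measurable_poweR q) (measurable_density v)).
- by apply/measurable_EFinP; exact: measurable_shift_density_powR.
- by move=> x _; exact: poweR_ge0.
- by move=> x _; rewrite lee_fin powR_ge0.
- by apply: filterS densE => x /(_ I) + _ => ->; rewrite poweR_EFin.
Qed.

Lemma KL_translate_le v :
  KL (translate pi v) pi <= (beta * enorm v ^+ 2 / 2)%:E.
Proof.
have [dom densE] := translate_dominated Vcont piV v.
rewrite /KL asboolT//.
rewrite (ae_eq_integral (fun x => (rho v x * ln (rho v x))%:E)) //.
- rewrite -[leLHS]fineK; first by rewrite lee_fin; exact: entropy_shift_density.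
  exact/integrable_fin_num/integrable_shift_density_ln.
- apply: emeasurable_funM; first exact: measurable_density.
  apply: measurableT_comp; [exact: measurable_lne|exact: measurable_density].
- exact: measurable_int (integrable_shift_density_ln v).
- apply: filterS densE => x /(_ I) + _ => ->.
  by rewrite lne_EFin ?shift_density_gt0.
Qed.

End divergence_bounds.

Section harnack.
Context {R : realType} {d : nat}.
Variables (beta : R) (V : 'rV[R]_d -> R) (pi : probability 'rV[R]_d R).
Hypotheses (Vsmooth : smooth V) (piV : gibbs V pi).
Hypothesis hessV : forall x, loewner_le (hessian V x) (beta%:M).
Implicit Types (v x : 'rV[R]_d) (f : 'rV[R]_d -> R).

Let Vcont : continuous V. Proof. by case: (smooth_C1 Vsmooth). Qed.
Local Notation rho := (shift_density V).
Local Open Scope ereal_scope.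

Let mrho v : measurable_fun setT (rho v).
Proof. exact: measurable_shift_density. Qed.

Lemma expectation_shift v f : measurable_fun setT f -> (forall x, 0 <= f x)%R ->
  'E_pi[fun x => f (x + v)%R] = \int[pi]_x (f x * rho v x)%:E.
Proof.
move=> mf f0; rewrite unlock.
rewrite (@ge0_integral_shift_density _ _ V pi Vcont piV v (EFin \o f))//.
exact/measurable_EFinP.
Qed.

(** Hoelder's inequality between [f] and the shift density, with the exponent
    [q = p / (p - 1)] conjugate to [p]. *)
Lemma shift_harnack (p : R) v f : (1 < p)%R -> measurable_fun setT f ->
  (forall x, 0 < f x)%R ->
  'E_pi[fun x => f (x + v)%R] `^ p
    <= (expR (beta * p * enorm v ^+ 2 / (2 * (p - 1))))%:E
       * 'E_pi[fun x => (f x `^ p)%R].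
Proof.
move=> p1 mf f0.
have f0' x : (0 <= f x)%R by exact: ltW.
have p0 : (0 < p)%R by rewrite (lt_trans _ p1).
have p10 : (0 < p - 1)%R by rewrite subr_gt0.
pose q := (p / (p - 1))%R.
have q0 : (0 < q)%R by rewrite divr_gt0.
have q1 : (1 < q)%R by rewrite /q ltr_pdivlMr// mul1r ltrBlDr ltrDl.
have pq : (p^-1 + q^-1 = 1)%R.
  by rewrite /q; field; rewrite !gt_eqF.
rewrite expectation_shift//.
rewrite [X in X `^ p](_ : _ = 'N[pi]_1[EFin \o (f \* rho v)%R]); last first.
  rewrite Lnorm1; apply: eq_integral => x _ /=.
  by rewrite ger0_norm// mulr_ge0// ltW// shift_density_gt0.
have := @hoelder _ _ _ pi f (rho v) p q mf (mrho v) p0 q0 pq.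
move=> /(gt0_ler_poweR (ltW p0)) => H.
apply: (le_trans (H _ _));
  rewrite ?in_itv/= ?leey ?andbT ?Lnorm_ge0 ?mule_ge0 ?Lnorm_ge0//.
rewrite poweRM ?Lnorm_ge0// poweR_Lnorm ?gt_eqF// muleC.
rewrite expectation.unlock.
rewrite [X in _ * X <= _](_ : _ = \int[pi]_x (f x `^ p)%:E); last first.
  by apply: eq_integral => x _; rewrite /= ger0_norm.
apply: lee_wpmul2r; first by apply: integral_ge0 => x _; rewrite lee_fin powR_ge0.
have -> : ('N[pi]_q%:E[EFin \o rho v] = (\int[pi]_x (rho v x `^ q)%:E) `^ q^-1).
  rewrite unlock; congr (_ `^ _); apply: eq_integral => x _ /=.
  by rewrite ger0_norm// ltW// shift_density_gt0.
have h := shift_density_moment Vsmooth piV hessV v (ltW q1).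
rewrite -poweRrM.
have qp0 : (0 <= q^-1 * p)%R by rewrite mulr_ge0 ?invr_ge0// ltW.
apply: (le_trans (gt0_ler_poweR qp0 _ _ h)).
- rewrite in_itv/= leey andbT; apply: integral_ge0 => x _.
  by rewrite lee_fin powR_ge0.
- by rewrite in_itv/= leey andbT lee_fin expR_ge0.
rewrite poweR_EFin -expRM lee_fin ler_expR le_eqVlt; apply/orP; left; apply/eqP.
by rewrite /q; field; rewrite !gt_eqF.
Qed.

(** Entropy duality between the shift density and [f]; when the exponential
    moment of [f] is infinite there is nothing to prove. *)
Lemma shift_log_harnack v f : measurable_fun setT f -> (forall x, 0 < f x)%R ->
  'E_pi[fun x => f (x + v)%R]
    <= lne 'E_pi[fun x => expR (f x)] + (beta * enorm v ^+ 2 / 2)%:E.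
Proof.
move=> mf f0.
have [Efoo|Efoo] := eqVneq 'E_pi[fun x => expR (f x)] +oo.
  by rewrite Efoo /= addye// leey.
have mexpf : measurable_fun setT (fun x => expR (f x)) by exact: measurableT_comp.
have iexp : pi.-integrable setT (EFin \o (fun x => expR (f x))).
  apply: ge0_integrable_lty => //.
  by rewrite ltey; move: Efoo; rewrite unlock.
(* f is positive, so expR (- f) is bounded by 1 *)
have iNexp : pi.-integrable setT (EFin \o (fun x => expR (- f x))).
  apply: (@integrable_dominated _ _ _ _ _ (cst 1%R)); last exact: finite_measure_integrable_cst.
    by apply: measurableT_comp => //; exact: measurableT_comp.
  by move=> x /=; rewrite ger0_norm ?expR_ge0// -expR0 ler_expR oppr_le0 ltW.
have irf := integrable_entropyM (mrho v) mf (shift_density_gt0 V v)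
  (integrable_shift_density_ln Vsmooth piV hessV v) iexp iNexp.
have E0 : (0 < \int[pi]_x expR (f x))%R.
  by apply: (Rintegral_gt0 iexp) => x; exact: expR_gt0.
have EE : 'E_pi[fun x => expR (f x)] = (\int[pi]_x expR (f x))%R%:E.
  by rewrite unlock fineK//; exact: integrable_fin_num.
rewrite expectation_shift//; last by move=> x; exact: ltW.
rewrite EE lne_EFin//.
under eq_integral do rewrite mulrC.
rewrite -[leLHS]fineK; last exact: integrable_fin_num.
rewrite -EFinD lee_fin.
have := entropy_variational (shift_density_gt0 V v)
  (integrable_shift_density Vsmooth piV v)
  (integrable_shift_density_ln Vsmooth piV hessV v) irf iexp.
rewrite (Rintegral_shift_density Vsmooth piV) ln1 mulr0 subr0 mul1r.
move=> /le_trans; apply.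
rewrite addrC lerD2l.
exact: entropy_shift_density.
Qed.

End harnack.

(** * Integration by parts and the gradient-entropy bound *)

Section integration_by_parts.
Context {R : realType} {d : nat}.
Implicit Types (h dh f V : 'rV[R]_d -> R) (e x : 'rV[R]_d).
Local Open Scope ereal_scope.
Local Notation mu := (@lebesgue_rV R d).

(** The integral of a directional derivative vanishes as soon as the function
    and its derivative are integrable: [h (x + e) - h x] is the integral of
    the derivative over the segment from [x] to [x + e], and both sides are
    integrated in [x] with Fubini's theorem and translation invariance. No
    decay or compact support is required. *)
Lemma integral_is_derive_eq0 e h dh : continuous dh ->
  (forall x, is_derive x e h (dh x)) ->
  mu.-integrable setT (EFin \o h) -> mu.-integrable setT (EFin \o dh) ->
  \int[mu]_x (dh x)%:E = 0.
Proof.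
move=> cdh hdh ih idh.
have mdh : measurable_fun setT (EFin \o dh) by exact: measurable_int idh.
have mh : measurable_fun setT (EFin \o h) by exact: measurable_int ih.
have line x (s : R) : is_derive s 1%R (fun s : R => h (x + s *: e)%R)
    (dh (x + s *: e)%R).
  exact/is_derive_along.
have cline x : continuous (fun s : R => dh (x + s *: e)%R).
  move=> s; apply: continuous_comp; last exact: cdh.
  by apply: cvgD; [exact: cvg_cst|apply: cvgZr_tmp; exact: cvg_id].
have ftc x : \int[lebesgue_measure]_(s in `[0%R, 1%R]) (dh (x + s *: e)%R)%:E =
    (h (x + e)%R)%:E - (h x)%:E.
  rewrite (@continuous_FTC2 R (fun s => dh (x + s *: e)%R)
    (fun s => h (x + s *: e)%R) 0%R 1%R) ?ltr01//.
  - by rewrite scale1r scale0r addr0.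
  - exact: continuous_subspaceT.
  - have ch : continuous (fun s : R => h (x + s *: e)%R).
      move=> s; apply/differentiable_continuous/derivable1_diffP.
      exact: ex_derive.
    split; [by move=> s _; exact: ex_derive| |].
      by apply: cvg_at_right_filter; exact: ch.
    by apply: cvg_at_left_filter; exact: ch.
  - by move=> s _; rewrite derive1E; exact: derive_val.
(* the restriction of s to [0, 1] is carried by an indicator, so that Fubini's
   theorem applies to a function on the whole product *)
pose F (p : 'rV[R]_d * R) : \bar R :=
  (dh (p.1 + p.2 *: e)%R)%:E * (\1_(`[0%R, 1%R]%classic) p.2)%:E.
have mF : measurable_fun setT F.
  apply: emeasurable_funM.
    apply: (measurableT_comp mdh).
    apply/measurable_fun_rVP => i; under eq_fun do rewrite !mxE.
    apply: measurable_funD.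
      exact: (measurableT_comp (measurable_coord_rV i) measurable_fst).
    by apply: measurable_funM => //.
  apply/measurable_EFinP; apply: (measurableT_comp _ measurable_snd).
  exact: measurable_indic.
have ind0 (s : R) : 0 <= (\1_(`[0%R, 1%R]%classic : set R) s)%:E :> \bar R.
  by rewrite lee_fin.
have one01 : \int[lebesgue_measure]_s (\1_(`[0%R, 1%R]%classic : set R) s)%:E = 1.
  rewrite integral_indic// setIT [LHS]lebesgue_measure_itv/= lte_fin ltr01.
  by rewrite oppr0 adde0.
have m01 : measurable_fun setT
    (fun s : R => (\1_(`[0%R, 1%R]%classic : set R) s)%:E : \bar R).
  by apply/measurable_EFinP; exact: measurable_indic.
have abs_slice (s : R) : \int[mu]_x `|F (x, s)| =
    \int[mu]_x `|(dh x)%:E| * (\1_(`[0%R, 1%R]%classic : set R) s)%:E.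
  rewrite -ge0_integralZr//; last exact: measurableT_comp.
  rewrite -[RHS](integral_lebesgue_rV_shift (s *: e)%R); last first.
    by apply: emeasurable_funM => //; exact: measurableT_comp.
  by apply: eq_integral => x _; rewrite /F abseM [X in _ * X]gee0_abs.
have slice (s : R) : \int[mu]_x F (x, s) =
    \int[mu]_x (dh x)%:E * (\1_(`[0%R, 1%R]%classic : set R) s)%:E.
  rewrite -integralZr// -[RHS](integral_lebesgue_rV_shift (s *: e)%R)//.
  exact: emeasurable_funM.
have iF : (mu \x (@lebesgue_measure R)).-integrable setT F.
  apply/integrable21ltyP => //.
  under eq_integral do rewrite abs_slice.
  rewrite ge0_integralZl//; last by apply: integral_ge0.
  by rewrite one01 mule1; case/integrableP : idh.
have := Fubini iF.
rewrite (eq_integral (fun x => (h (x + e)%R)%:E - (h x)%:E)); last first.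
  move=> x _; rewrite -ftc [RHS]integral_mkcond; apply: eq_integral => s _.
  by rewrite /F patchE indicE; case: ifP; rewrite ?mule1 ?mule0.
under [X in _ = X -> _]eq_integral do rewrite slice.
have i01 : lebesgue_measure.-integrable setT
    (fun s : R => (\1_(`[0%R, 1%R]%classic : set R) s)%:E : \bar R).
  apply/integrableP; split => //.
  by under eq_integral do rewrite gee0_abs//; rewrite one01 ltry.
rewrite -[in RHS](fineK (integrable_fin_num measurableT idh)) integralZl// one01.
rewrite mule1 fineK; last exact: (integrable_fin_num measurableT idh).
move=> <-.
have ihs : mu.-integrable setT (fun x => (h (x + e)%R)%:E).
  apply/integrableP; split.
    by apply: (measurableT_comp mh); exact: measurable_shift_rV.
  rewrite (integral_lebesgue_rV_shift e (f := fun x => `|(h x)%:E|)).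
    by case/integrableP : ih.
  exact: measurableT_comp.
rewrite integralB// (integral_lebesgue_rV_shift e (f := EFin \o h))// subee//.
exact: (integrable_fin_num measurableT ih).
Qed.

End integration_by_parts.

Section gradient_entropy.
Context {R : realType} {d : nat}.
Variables (beta : R) (V : 'rV[R]_d -> R) (pi : probability 'rV[R]_d R).
Hypotheses (Vsmooth : smooth V) (piV : gibbs V pi).
Implicit Types (f g : 'rV[R]_d -> R) (u x : 'rV[R]_d) (i : 'I_d).
Local Notation mu := (@lebesgue_rV R d).
Local Notation L1 f := (pi.-integrable setT (EFin \o f)).

Let C1V : C1 V. Proof. exact: smooth_C1. Qed.
Let Vcont : continuous V. Proof. by case: C1V. Qed.
Let mV : measurable_fun setT V. Proof. exact: continuous_measurable_rV. Qed.

Lemma continuous_partial i f : C1 f -> continuous (partial i f).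
Proof. by case=> _ /(_ i)[]. Qed.

Lemma measurable_partial i f : C1 f -> measurable_fun setT (partial i f).
Proof.
by move=> C1f; apply: continuous_measurable_rV; exact: continuous_partial.
Qed.

Lemma measurable_C1 f : C1 f -> measurable_fun setT f.
Proof. by case=> cf _; exact: continuous_measurable_rV. Qed.

Lemma integrable_gibbs g : L1 g ->
  mu.-integrable setT (EFin \o (fun x => g x * expR (- V x))).
Proof.
move=> ig; have [c c0 piE] := ge0_integral_gibbs Vcont piV.
have mg : measurable_fun setT (EFin \o g) by exact: measurable_int ig.
have mexp : measurable_fun setT (fun x => expR (- V x)).
  by apply: measurableT_comp => //; exact: measurableT_comp.
apply/integrableP; split.
  by apply/measurable_EFinP; apply: measurable_funM => //; exact/measurable_EFinP.
have : (\int[pi]_x `|(EFin \o g) x| < +oo)%E by case/integrableP : ig.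
rewrite piE//; last exact: measurableT_comp.
rewrite (eq_integral (fun x => `|(g x * expR (- V x))%:E|%E)); last first.
  by move=> x _; rewrite /= normrM EFinM [X in (_ * X%:E)%E]ger0_norm ?expR_ge0.
rewrite ltNge => /negP coo; rewrite ltNge leye_eq; apply/negP => /eqP E.
by apply: coo; rewrite E gt0_muley ?lte_fin.
Qed.

Lemma Rintegral_gibbs : exists2 c : R, 0 < c &
  forall g, L1 g -> \int[pi]_x g x = c * \int[mu]_x (g x * expR (- V x)).
Proof.
have [c c0 piE] := ge0_integral_gibbs Vcont piV; exists c => // g ig.
have ge0E k : L1 k -> (forall x, 0 <= k x) ->
    \int[pi]_x k x = c * \int[mu]_x (k x * expR (- V x)).
  move=> ik k0; rewrite /Rintegral piE//; first last.
    exact: measurable_int ik.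
  rewrite -[in LHS](fineK (integrable_fin_num measurableT (integrable_gibbs ik))).
  by rewrite -EFinM.
have iNg : L1 (fun x => `|g x|) by exact: integrable_norm ig.
have iB : L1 (fun x => `|g x| - g x).
  exact: (@integrableB _ _ _ pi setT measurableT (EFin \o (fun x => `|g x|))
    (EFin \o g)).
(* g is the difference of the nonnegative functions |g| and |g| - g *)
have -> : \int[pi]_x g x = \int[pi]_x (`|g x| - (`|g x| - g x)).
  by apply: eq_Rintegral => x _; rewrite subKr.
rewrite RintegralB// !ge0E//; last by move=> x; rewrite subr_ge0 ler_norm.
rewrite -mulrBr -RintegralB//; [|exact: integrable_gibbs..].
by congr (_ * _); apply: eq_Rintegral => x _; rewrite -mulrBl subKr.
Qed.

(** The integral of the [i]-th partial derivative of [f * expR (- V)]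
    vanishes. *)
Lemma gibbs_integration_by_parts i f : C1 f -> L1 f -> L1 (partial i f) ->
  L1 (fun x => f x * partial i V x) ->
  \int[pi]_x partial i f x = \int[pi]_x (f x * partial i V x).
Proof.
move=> C1f i_f idf ifdV; apply/eqP; rewrite -subr_eq0 -RintegralB//; apply/eqP.
have ig : L1 (fun x => partial i f x - f x * partial i V x).
  exact: (@integrableB _ _ _ pi setT measurableT (EFin \o partial i f)
    (EFin \o (fun x => f x * partial i V x))).
have [c _ ->] := Rintegral_gibbs; last exact: ig.
suff E0 : (\int[mu]_x
    ((partial i f x - f x * partial i V x) * expR (- V x))%:E = 0)%E.
  by rewrite /Rintegral E0 mulr0.
apply: (@integral_is_derive_eq0 _ _ (delta_mx 0 i) (fun x => f x * expR (- V x))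
  (fun x => (partial i f x - f x * partial i V x) * expR (- V x))).
- have [cf _] := C1f.
  have cdf := continuous_partial (i := i) C1f.
  have cdV := continuous_partial (i := i) C1V.
  have cexp : continuous (fun x => expR (- V x)).
    move=> x; apply: (@continuous_comp _ _ _ (fun x => - V x) expR).
      by apply: continuousN; exact: Vcont.
    exact: continuous_expR.
  move=> x.
  exact: (cvgM (cvgB (cdf x) (cvgM (cf x) (cdV x))) (cexp x)).
- move=> x; rewrite -[x in is_derive x](addr0 x) -(scale0r (delta_mx 0 i)).
  apply/is_derive_alongP.
  have df : is_derive (0 : R) 1 (fun s : R => f (x + s *: delta_mx 0 i))
      (partial i f x).
    apply/is_derive_alongP; rewrite scale0r addr0; apply: derivableP.
    by case: C1f => _ /(_ i)[].
  have dV : is_derive (0 : R) 1 (fun s : R => V (x + s *: delta_mx 0 i))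
      (partial i V x).
    apply/is_derive_alongP; rewrite scale0r addr0; apply: derivableP.
    by case: C1V => _ /(_ i)[].
  have dexp : is_derive (0 : R) 1 (fun s : R => expR (- V (x + s *: delta_mx 0 i)))
      (- partial i V x * expR (- V x)).
    apply: is_derive_eq (is_derive1_comp (is_derive_expR _) (is_deriveN dV)) _.
    by rewrite opprfctE scale0r addr0 mulrC.
  apply: is_derive_eq.
  by rewrite scale0r addr0 /GRing.scale /=; ring.
- exact: integrable_gibbs.
- exact: integrable_gibbs.
Qed.

Lemma measurable_dotv_gradient u :
  measurable_fun setT (fun x => dotv (gradient V x) u).
Proof.
apply: measurable_sum => i; apply: measurable_funM => //.
under eq_fun do rewrite mxE.
exact: measurable_partial.
Qed.

Hypothesis hessV : forall x, loewner_le (hessian V x) (beta%:M).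

(** [dotv (gradient V x) u] is at most [V x - V (x - u)] plus a quadratic term,
    and the exponential of [V x - V (x - u)] is the density of the shift by
    [u], which integrates to one. *)
Lemma exp_gradient_moment u :
  (\int[pi]_x (expR (dotv (gradient V x) u))%:E <=
    (expR (beta * enorm u ^+ 2 / 2))%:E)%E.
Proof.
set C := expR (_ / 2).
have mrho : measurable_fun setT (fun x => (shift_density V u x)%:E).
  by apply/measurable_EFinP; exact: measurable_shift_density.
apply: (@le_trans _ _ (\int[pi]_x (C%:E * (shift_density V u x)%:E))%E).
  apply: ge0_le_integral => //.
  - apply/measurable_EFinP; apply: measurableT_comp => //.
    exact: measurable_dotv_gradient.
  - exact: measurable_funeM.
  - move=> x _; rewrite lee_fin /shift_density -expRD ler_expR.
    have := taylor_hessian_le Vsmooth hessV x (- u).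
    by rewrite enormN dotvN; lra.
rewrite ge0_integralZl//.
- by rewrite (integral_shift_density1 Vcont piV) mule1.
- by move=> x _; rewrite lee_fin ltW// shift_density_gt0.
- by rewrite lee_fin expR_ge0.
Qed.

Lemma integrable_exp_gradient u : L1 (fun x => expR (dotv (gradient V x) u)).
Proof.
apply: ge0_integrable_lty => //.
  by apply: measurableT_comp => //; exact: measurable_dotv_gradient.
by rewrite (le_lt_trans (exp_gradient_moment u))// ltry.
Qed.

Lemma integrable_entropy_gradient u f : measurable_fun setT f ->
  (forall x, 0 < f x) -> L1 (fun x => f x * ln (f x)) ->
  L1 (fun x => f x * dotv (gradient V x) u).
Proof.
move=> mf f0 iflnf; apply: integrable_entropyM => //.
- exact: measurable_dotv_gradient.
- exact: integrable_exp_gradient.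
- apply: eq_integrable (integrable_exp_gradient (- u)) => // x _ /=.
  by rewrite dotvN.
Qed.

Lemma entropy_gradient_le u f : (forall x, 0 < f x) -> L1 f ->
  L1 (fun x => f x * ln (f x)) ->
  \int[pi]_x (f x * dotv (gradient V x) u) <=
    \int[pi]_x (f x * ln (f x)) - (\int[pi]_x f x) * ln (\int[pi]_x f x)
    + (\int[pi]_x f x) * (beta * enorm u ^+ 2 / 2).
Proof.
move=> f0 i_f iflnf.
have mf : measurable_fun setT f.
  by apply/measurable_EFinP; exact: measurable_int i_f.
have iexp := integrable_exp_gradient u.
have iw := integrable_entropy_gradient u mf f0 iflnf.
apply: (le_trans (entropy_variational f0 i_f iflnf iw iexp)).
rewrite lerD2l ler_wpM2l//; first exact/ltW/Rintegral_gt0.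
rewrite -[leRHS]expRK ler_ln ?posrE ?expR_gt0//.
  rewrite -lee_fin fineK; last exact: integrable_fin_num.
  exact: exp_gradient_moment.
by apply: (Rintegral_gt0 iexp) => x; exact: expR_gt0.
Qed.

Lemma measurable_enorm_gradient f : C1 f ->
  measurable_fun setT (fun x => enorm (gradient f x)).
Proof.
move=> C1f; apply: (measurableT_comp
  (continuous_measurable_fun (@sqrt_continuous R))).
apply: measurable_sum => i; apply: measurable_funX.
under eq_fun do rewrite mxE.
exact: measurable_partial.
Qed.

Lemma normr_partial_le i f x : `|partial i f x| <= enorm (gradient f x).
Proof.
rewrite -sqrtr_sqr /enorm ler_sqrt ?sumr_ge0// => [|j _]; last exact: sqr_ge0.
rewrite (bigD1 i)//= mxE lerDl sumr_ge0// => j _; exact: sqr_ge0.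
Qed.

Lemma Rintegral_dotv u f : (forall i, L1 (fun x => f x * partial i V x)) ->
  \int[pi]_x (f x * dotv (gradient V x) u) =
  \sum_i u 0 i * \int[pi]_x (f x * partial i V x).
Proof.
move=> ifdV.
rewrite (@eq_Rintegral _ _ _ pi setT
  (fun x => \sum_i u 0 i * (f x * partial i V x))); last first.
  move=> x _; rewrite mulr_sumr; apply: eq_bigr => i _.
  by rewrite mxE mulrA mulrC.
rewrite /Rintegral; under eq_integral do rewrite -sumEFin.
have iu i := integrableZl measurableT (u 0 i) (ifdV i).
rewrite integral_sum//.
rewrite (eq_bigr (fun i => (u 0 i * \int[pi]_x (f x * partial i V x))%:E)).
  by rewrite sumEFin.
move=> i _; rewrite -RintegralZl// fineK//.
exact: (integrable_fin_num measurableT (iu i)).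
Qed.

(** Let [G] be the expectation of the gradient of [f], and [m] that of [f].
    Integration by parts gives [E (f * dotv (gradient V) G) = enorm G ^+ 2],
    and entropy duality against [dotv (gradient V) u] bounds it. *)
Lemma gradient_entropy_bound f : 0 < beta -> smooth f -> (forall x, 0 < f x) ->
  ('E_pi[fun x => enorm (gradient f x)] < +oo)%E ->
  ('E_pi[f] < +oo)%E ->
  ('E_pi[fun x => (f x * `|ln (f x)|)%R] < +oo)%E ->
  ((enorm (expectation_rV pi (gradient f)) ^+ 2 / fine 'E_pi[f])%:E
     <= (2 * beta)%:E * ent pi f)%E.
Proof.
move=> beta0 sf f0 gradoo foo flnfoo.
have C1f := smooth_C1 sf.
have mf := measurable_C1 C1f.
have i_f : L1 f.
  by apply: ge0_integrable_lty => // [x|]; [exact: ltW|rewrite unlock in foo].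
have mlnf : measurable_fun setT (fun x => ln (f x)) by exact: measurableT_comp.
have iflnf : L1 (fun x => f x * ln (f x)).
  apply: (@integrable_dominated _ _ _ _ _ (fun x => f x * `|ln (f x)|)).
  - exact: measurable_funM.
  - by move=> x; rewrite normrM gtr0_norm.
  - apply: ge0_integrable_lty.
    + by apply: measurable_funM => //; exact: measurableT_comp.
    + by move=> x; rewrite mulr_ge0// ltW.
    + by rewrite unlock in flnfoo.
have idf i : L1 (partial i f).
  apply: (@integrable_dominated _ _ _ _ _ (fun x => enorm (gradient f x))).
  - exact: measurable_partial.
  - exact: normr_partial_le.
  - apply: ge0_integrable_lty.
    + exact: measurable_enorm_gradient.
    + by move=> x; exact: sqrtr_ge0.
    + by rewrite unlock in gradoo.
have ifdV i : L1 (fun x => f x * partial i V x).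
  apply: eq_integrable
    (integrable_entropy_gradient (delta_mx 0 i) mf f0 iflnf) => //.
  move=> x _ /=; rewrite /dotv (bigD1 i)//= !mxE !eqxx mulr1 big1 ?addr0// => j ji.
  by rewrite !mxE eqxx (negbTE ji) mulr0.
set G := expectation_rV pi (gradient f).
have GE i : G 0 i = \int[pi]_x (f x * partial i V x).
  rewrite /G mxE unlock -gibbs_integration_by_parts//.
  by congr fine; apply: eq_integral => x _; rewrite mxE.
set m := \int[pi]_x f x.
have m0 : 0 < m by exact: Rintegral_gt0.
have Ef : ('E_pi[f] = m%:E)%E by rewrite unlock fineK//; exact: integrable_fin_num.
have -> : ent pi f = (\int[pi]_x (f x * ln (f x)) - m * ln m)%:E.
  rewrite /ent Ef lne_EFin// EFinB EFinM; congr (_ - _)%E.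
  by rewrite unlock fineK//; exact: integrable_fin_num.
rewrite Ef /= -EFinM lee_fin.
(* this multiple of G is the optimal direction *)
have := entropy_gradient_le ((m * beta)^-1 *: G) f0 i_f iflnf.
rewrite Rintegral_dotv// -/m.
set Ent := _ - _.
rewrite (_ : \sum_i _ = (m * beta)^-1 * enorm G ^+ 2); last first.
  by rewrite sqr_enorm mulr_sumr; apply: eq_bigr => i _; rewrite mxE GE -mulrA.
rewrite (_ : enorm (_ *: _) ^+ 2 = (m * beta)^-1 ^+ 2 * enorm G ^+ 2); last first.
  by rewrite !sqr_enorm mulr_sumr; apply: eq_bigr => i _; rewrite mxE exprMn.
set N := enorm G ^+ 2 => H.
have mb0 : m * beta != 0 by rewrite mulf_neq0// gt_eqF.
have : N / m / (2 * beta) <= Ent.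
  rewrite (_ : N / m / (2 * beta) = (m * beta)^-1 * N
      - m * (beta * ((m * beta)^-1 ^+ 2 * N) / 2)).
    by rewrite lerBlDr.
  by field; rewrite !gt_eqF.
by rewrite ler_pdivrMr ?mulr_gt0// [X in _ <= X -> _]mulrC.
Qed.

End gradient_entropy.

Theorem corollary5p3 (R : realType) (d : nat) (beta : R)
    (V : 'rV[R]_d -> R) (pi : probability 'rV[R]_d R) :
  0 < beta -> smooth V -> gibbs V pi ->
  (forall x, loewner_le ((- beta)%:M) (hessian V x) /\
             loewner_le (hessian V x) (beta%:M)) ->
  [/\ (* gradient-entropy bound *)
      forall f : 'rV[R]_d -> R,
        smooth f -> (forall x, 0 < f x) ->
        ('E_pi[fun x => enorm (gradient f x)] < +oo)%E ->
        ('E_pi[f] < +oo)%E ->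
        ('E_pi[fun x => (f x * `|ln (f x)|)%R] < +oo)%E ->
        ((enorm (expectation_rV pi (gradient f)) ^+ 2 / fine 'E_pi[f])%:E
           <= (2 * beta)%:E * ent pi f)%E,
      (* shift Harnack inequality *)
      forall (p : R) (v : 'rV[R]_d) (f : 'rV[R]_d -> R),
        1 < p -> measurable_fun setT f -> (forall x, 0 < f x) ->
        ('E_pi[fun x => f (x + v)%R] `^ p
           <= (expR (beta * p * enorm v ^+ 2 / (2 * (p - 1))))%:E
              * 'E_pi[fun x => (f x `^ p)%R])%E,
      (* reverse Renyi transport inequality *)
      forall (q : R) (v : 'rV[R]_d),
        1 < q ->
        (renyi q (translate pi v) pi <= (beta * q * enorm v ^+ 2 / 2)%:E)%E,
      (* shift log-Harnack inequality *)
      forall (v : 'rV[R]_d) (f : 'rV[R]_d -> R),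
        measurable_fun setT f -> (forall x, 0 < f x) ->
        ('E_pi[fun x => f (x + v)%R]
           <= lne 'E_pi[fun x => expR (f x)]
              + (beta * enorm v ^+ 2 / 2)%:E)%E
    & (* reverse KL transport inequality *)
      forall v : 'rV[R]_d,
        (KL (translate pi v) pi <= (beta * enorm v ^+ 2 / 2)%:E)%E].
Proof.
move=> beta0 sV piV hessV.
have hessV' x : loewner_le (hessian V x) beta%:M by have [] := hessV x.
split.
- by move=> f sf f0 gradoo foo flnfoo; exact: (gradient_entropy_bound sV piV hessV').
- by move=> p v f p1 mf f0; exact: (shift_harnack sV piV hessV').
- by move=> q v q1; exact: (renyi_translate_le sV piV hessV').
- by move=> v f mf f0; exact: (shift_log_harnack sV piV hessV').
- by move=> v; exact: (KL_translate_le sV piV hessV').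
Qed.
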